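(* For all integers $n \geq 0$, $$\sigma_{e}\mathrm{Mex}(n) \equiv \sigma\mathrm{Mex}(n) - \bar{p}_{\geq 2}(n) \pmod{2^2}.$$
   Context: An overpartition of a non-negative integer $n$ is a partition of $n$ (a finite non-increasing sequence of positive integers with sum $n$) in which the first occurrence of each distinct part may or may not be overlined; the empty overpartition is the only overpartition of $0$. Let $\bar{P}(n)$ be the set of all overpartitions of $n$. For $\lambda\in\bar P(n)$, $\mathrm{Mex}(\lambda)$ is the smallest positive integer that does not occur as a part of $\lambda$, whether overlined or non-overlined (so $\mathrm{Mex}$ of the empty overpartition is $1$). Let $\mathrm{Mex}_e(\lambda)=\mathrm{Mex}(\lambda)$ if $\mathrm{Mex}(\lambda)$ is even, and $\mathrm{Mex}_e(\lambda)=0$ otherwise. Define $\sigma\mathrm{Mex}(n)=\sum_{\lambda\in\bar P(n)}\mathrm{Mex}(\lambda)$ and $\sigma_e\mathrm{Mex}(n)=\sum_{\lambda\in\bar P(n)}\mathrm{Mex}_e(\lambda)$. Let $\bar p_{\geq 2}(n)$ be the number of overpartitions of $n$ all of whose parts are at least $2$ (with $\bar p_{\geq 2}(0)=1$). *)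

(* Defs.v *)
From mathcomp Require Import all_boot all_order all_algebra.

Set Implicit Arguments.
Unset Strict Implicit.
Unset Printing Implicit Defensive.

(* A part is a pair (k, b): the integer k, overlined iff b = true. *)
Definition parts (s : seq (nat * bool)) : seq nat := unzip1 s.

(* The last condition says that only the first occurrence of each part
   size may be overlined. *)
Definition is_overpartition (n : nat) (s : seq (nat * bool)) : bool :=
  [&& sorted geq (parts s),
      all (leq 1) (parts s),
      sumn (parts s) == n
    & all (fun i => (nth (0, false) s i).2
                    ==> (index (nth 0 (parts s) i) (parts s) == i))
          (iota 0 (size s))].

(* An overpartition of n has at most n parts, each at most n, so that the
   overpartitions of n form a subset of the finite type below; nothing is lost,
   see opseq_inj and overpartitionsP. *)
Definition opseq (n : nat) (l : n.-bseq ('I_n.+1 * bool)) : seq (nat * bool) :=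
  [seq (val x.1, x.2) | x <- l].

Definition overpartitions (n : nat) : {set n.-bseq ('I_n.+1 * bool)} :=
  [set l | is_overpartition n (opseq l)].

Lemma opseq_inj (n : nat) : injective (@opseq n).
Proof.
move=> l1 l2 /inj_map eql; apply/val_inj/eql.
by move=> [i b] [j c] [/val_inj -> ->].
Qed.

Lemma overpartitionsP (n : nat) (s : seq (nat * bool)) :
  reflect (exists2 l, l \in overpartitions n & opseq l = s)
          (is_overpartition n s).
Proof.
apply: (iffP idP) => [sP | [l + <-]]; last by rewrite inE.
have /and4P[_ pos /eqP sumE _] := sP.
have bound : (size s <= n) && all (fun x => x.1 <= n) s.
  move: pos; rewrite -sumE; elim: s {sP sumE} => //= x s IHs /andP[x1 /IHs].
  case/andP=> szs les; rewrite leq_addr -add1n leq_add //=.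
  by apply: sub_all les => y /leq_trans-> //; rewrite leq_addl.
case/andP: bound => szs /allP les.
have szl : size [seq (inord x.1 : 'I_n.+1, x.2) | x <- s] <= n by rewrite size_map.
have lE : opseq (Bseq szl) = s.
  rewrite /opseq /= -map_comp -[RHS]map_id; apply/eq_in_map => -[k b] /les /= lek.
  by rewrite inordK.
by exists (Bseq szl); rewrite // inE lE.
Qed.

Lemma mex_exists (s : seq (nat * bool)) :
  exists m, (0 < m) && (m \notin parts s).
Proof.
exists (sumn (parts s)).+1; apply/negP.
suff le_sum t k : k \in t -> k <= sumn t by move/le_sum; rewrite ltnn.
elim: t => //= j t IHt; rewrite inE => /predU1P[-> | /IHt]; first exact: leq_addr.
by move=> lek; rewrite (leq_trans lek) // leq_addl.
Qed.

Definition Mex (s : seq (nat * bool)) : nat := ex_minn (mex_exists s).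

Definition Mex_e (s : seq (nat * bool)) : nat := if odd (Mex s) then 0 else Mex s.

Definition sigmaMex (n : nat) : nat :=
  \sum_(l in overpartitions n) Mex (opseq l).

Definition sigmaMex_e (n : nat) : nat :=
  \sum_(l in overpartitions n) Mex_e (opseq l).

Definition pbar_ge2 (n : nat) : nat :=
  #|[set l in overpartitions n | all (leq 2) (parts (opseq l))]|.

(* Main.v *)
Require Import Defs.
From mathcomp Require Import all_boot all_order all_algebra.

(** Only overpartitions of odd mex m matter. Those with m = 1 are exactly the
    overpartitions without part 1, and each contributes 1. If m is odd and at
    least 3, then both 1 and 2 occur as parts, and the overlines on their first
    occurrences can be chosen freely without changing m, so that these
    overpartitions come in groups of four of equal mex. *)

(** The involution swaps the halves [b] and [~~ b] of [P] and keeps the weight. One half stays as a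
    sum of the same shape, so the lemma can be applied again to it. *)
Lemma sum_involution (T : finType) (P b : pred T) (t : T -> T) (F : T -> nat) :
    involutive t -> (forall x, P (t x) = P x) ->
    (forall x, P x -> b (t x) = ~~ b x) -> (forall x, F (t x) = F x) ->
  \sum_(x | P x) F x = 2 * \sum_(x | P x && ~~ b x) F x.
Proof.
move=> tK Pt bt Ft; rewrite (bigID b) /= mul2n -addnn; congr (_ + _).
rewrite (reindex_inj (inv_inj tK)) /=; apply: eq_big => [x | x _]; last exact: Ft.
by rewrite Pt; case Px: (P x) => //=; rewrite bt.
Qed.

Section Toggle.

Context {A : Type}.
Implicit Types (p q : pred A) (s : seq (A * bool)).

(** Selecting the part by a predicate lets the same flip act on lists over ['I_n.+1] and on lists
    over [nat]; [map_toggle] relates the two. *)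
Fixpoint toggle p s : seq (A * bool) :=
  if s is x :: s' then
    if p x.1 then (x.1, ~~ x.2) :: s' else x :: toggle p s'
  else [::].

Fixpoint first_mark p s : bool :=
  if s is x :: s' then if p x.1 then x.2 else first_mark p s' else false.

Lemma size_toggle p s : size (toggle p s) = size s.
Proof. by elim: s => //= x s IHs; case: ifP => //= _; rewrite IHs. Qed.

Lemma unzip1_toggle p s : unzip1 (toggle p s) = unzip1 s.
Proof. by elim: s => //= x s IHs; case: ifP => //= _; rewrite IHs. Qed.

Lemma toggleK p : involutive (toggle p).
Proof.
elim=> //= [[a b] s] IHs /=; case: ifP => /= pa; rewrite pa ?negbK //.
by rewrite IHs.
Qed.

Lemma first_mark_toggle p s :
  has p (unzip1 s) -> first_mark p (toggle p s) = ~~ first_mark p s.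
Proof. by elim: s => //= x s IHs; case: ifP => /= px; rewrite px. Qed.

Lemma first_mark_toggle_disjoint p q s :
    (forall a, p a -> ~~ q a) ->
  first_mark p (toggle q s) = first_mark p s.
Proof.
move=> pq; elim: s => //= x s IHs; case: ifP => /= qx; last by rewrite IHs.
by case: ifP => // /pq; rewrite qx.
Qed.

Lemma nth_toggle a p s i :
  i != find p (unzip1 s) -> nth (a, false) (toggle p s) i = nth (a, false) s i.
Proof. by elim: s i => //= x s IHs [|i]; case: ifP => //= px /IHs. Qed.

End Toggle.

Lemma map_toggle (A B : Type) (f : A -> B) (p : pred B) s :
  [seq (f x.1, x.2) | x <- toggle (preim f p) s] =
  toggle p [seq (f x.1, x.2) | x <- s].
Proof. by elim: s => //= x s IHs; case: ifP => //= _; rewrite IHs. Qed.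

(** The parts are unchanged, and the only overline that can change is at the first occurrence of
    [k], where both choices are allowed. *)
Lemma is_overpartition_toggle n k s :
  is_overpartition n (toggle (pred1 k) s) = is_overpartition n s.
Proof.
rewrite /is_overpartition /parts unzip1_toggle size_toggle; congr [&& _, _, _ & _].
apply: eq_in_all => i; rewrite mem_iota /= => lti.
have [-> | nei] := eqVneq i (index k (unzip1 s)); last by rewrite nth_toggle.
(* If [k] is absent, its index is the length of the list, and both [nth] return the default. *)
have [ks | /memNindex ->] := boolP (k \in unzip1 s).
  by rewrite nth_index // eqxx !implybT.
by rewrite !nth_default ?size_toggle // size_map.
Qed.

Lemma Mex_gt0 s : 0 < Mex s.
Proof. by rewrite /Mex; case: ex_minnP => m /andP[]. Qed.

Lemma Mex_notin s : Mex s \notin parts s.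
Proof. by rewrite /Mex; case: ex_minnP => m /andP[]. Qed.

Lemma mem_lt_Mex s k : 0 < k < Mex s -> k \in parts s.
Proof.
rewrite /Mex; case: ex_minnP => m _ min_m /andP[k0 ltkm].
by apply: contraLR ltkm => ks; rewrite -leqNgt min_m // k0.
Qed.

Lemma Mex_le s k : 0 < k -> k \notin parts s -> Mex s <= k.
Proof. by move=> k0; apply: contraR; rewrite -ltnNge => ltk; rewrite mem_lt_Mex ?k0. Qed.

Lemma eq_Mex s t : parts s = parts t -> Mex s = Mex t.
Proof.
move=> eq_st; apply/eqP; rewrite eqn_leq; apply/andP; split.
  by rewrite Mex_le ?Mex_gt0 // eq_st Mex_notin.
by rewrite Mex_le ?Mex_gt0 // -eq_st Mex_notin.
Qed.

Lemma Mex_eq1 s : all (leq 1) (parts s) -> (Mex s == 1) = all (leq 2) (parts s).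
Proof.
move=> /allP pos; apply/eqP/allP => [mex1 k ks | ge2].
  rewrite ltn_neqAle pos // andbT; apply: contraL ks => /eqP <-.
  by rewrite -[1]mex1 Mex_notin.
apply/eqP; rewrite eqn_leq Mex_gt0 andbT Mex_le //.
by apply/negP => /ge2.
Qed.

Section BoundedToggle.

Variable n : nat.
Implicit Type l : n.-bseq ('I_n.+1 * bool).

(** Toggling keeps the length, so [insubd] returns the toggled list itself. *)
Definition btoggle (k : nat) l : n.-bseq ('I_n.+1 * bool) :=
  insubd l (toggle (preim val (pred1 k)) l).

Lemma val_btoggle k l : btoggle k l = toggle (preim val (pred1 k)) l :> seq _.
Proof. by rewrite val_insubd size_toggle size_bseq. Qed.

Lemma btoggleK k : involutive (btoggle k).
Proof. by move=> l; apply: val_inj; rewrite /= !val_btoggle toggleK. Qed.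

Lemma opseq_btoggle k l : opseq (btoggle k l) = toggle (pred1 k) (opseq l).
Proof. by rewrite /opseq val_btoggle map_toggle. Qed.

Lemma Mex_btoggle k l : Mex (opseq (btoggle k l)) = Mex (opseq l).
Proof. by apply: eq_Mex; rewrite opseq_btoggle /parts unzip1_toggle. Qed.

Lemma overpartitions_btoggle k l :
  (btoggle k l \in overpartitions n) = (l \in overpartitions n).
Proof. by rewrite !inE opseq_btoggle is_overpartition_toggle. Qed.

End BoundedToggle.

Lemma dvdn4_sum_Mex n :
  4 %| \sum_(l in overpartitions n | odd (Mex (opseq l)) && (Mex (opseq l) != 1))
         Mex (opseq l).
Proof.
have mark k (l : n.-bseq ('I_n.+1 * bool)) :
    0 < k < 3 -> odd (Mex (opseq l)) && (Mex (opseq l) != 1) ->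
  first_mark (pred1 k) (opseq (btoggle n k l)) = ~~ first_mark (pred1 k) (opseq l).
  move=> /andP[k0 ltk3] mex_odd; rewrite opseq_btoggle first_mark_toggle //.
  rewrite has_pred1 mem_lt_Mex // k0 (leq_trans ltk3) //.
  (* 0 and 2 are even and 1 is excluded, so the mex is at least 3. *)
  by case: (Mex _) mex_odd => [|[|[|]]].
rewrite (sum_involution _ _ (fun l => first_mark (pred1 1) (opseq l)) (btoggle n 1)).
- rewrite (sum_involution _ _ (fun l => first_mark (pred1 2) (opseq l)) (btoggle n 2)).
  + by rewrite mulnA dvdn_mulr.
  + exact: btoggleK.
  (* The second flip must stay in the half chosen by the first: flipping the mark of 2 leaves the
     mark of 1 alone. *)
  + move=> l; rewrite overpartitions_btoggle Mex_btoggle opseq_btoggle.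
    by rewrite first_mark_toggle_disjoint // => _ /eqP ->.
  + by move=> l /andP[/andP[_ mex_odd] _]; exact: mark.
  + by move=> l; exact: Mex_btoggle.
- exact: btoggleK.
- by move=> l; rewrite overpartitions_btoggle Mex_btoggle.
- by move=> l /andP[_ mex_odd]; exact: mark.
- by move=> l; exact: Mex_btoggle.
Qed.

Lemma sigmaMex_split n :
  sigmaMex n = sigmaMex_e n + (pbar_ge2 n +
    \sum_(l in overpartitions n | odd (Mex (opseq l)) && (Mex (opseq l) != 1))
       Mex (opseq l)).
Proof.
rewrite /sigmaMex /sigmaMex_e /pbar_ge2 -sum1_card.
(* With [pbar_ge2 n] written as a sum of 1 over mex 1, all conditions can move into the summands,
   and the identity is checked termwise. *)
rewrite [X in _ + (X + _)](eq_bigl (fun l =>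
  (l \in overpartitions n) && (Mex (opseq l) == 1))).
  rewrite !big_mkcondr /= -!big_split /=; apply: eq_bigr => l _.
  rewrite /Mex_e; have [-> //|_] := eqVneq (Mex (opseq l)) 1.
  by rewrite andbT; case: odd; rewrite /= ?addn0.
move=> l; rewrite !inE; case sP: (is_overpartition _ _) => //=.
by rewrite Mex_eq1 //; case/and4P: sP.
Qed.

Import GRing.Theory.
Local Open Scope ring_scope.

Theorem corollary1p8 (n : nat) :
  ((sigmaMex_e n)%:Z = (sigmaMex n)%:Z - (pbar_ge2 n)%:Z %[mod 2 ^+ 2])%Z.
Proof.
have /dvdnP[m mE] := dvdn4_sum_Mex n.
rewrite sigmaMex_split mE !PoszD PoszM.
(* [pbar_ge2 n] cancels, which leaves [m * 4 + sigmaMex_e n]; the modulus [2 ^+ 2] computes to 4. *)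
rewrite addrCA [X in (_ = X %[mod _])%Z]addrC addKr addrC.
by rewrite modzMDl.
Qed.
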